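(* Let $X$ be a multiplicity graph of total multiplicity $n$, with lift $X'$ and projection $\pi:V(X')\to V(X)$. For bijections $\sigma,\tau:[n]\to V(X')$, the arrangements $\pi\circ\sigma$ and $\pi\circ\tau$ lie in the same connected component of $\mathsf{FS}_m(\mathsf{Path}_n,X)$ if and only if $\alpha_{\overline{X'}}(\sigma)\equiv\alpha_{\overline{X'}}(\tau)$.
   Context: A multiplicity graph is a simple graph $X$ with multiplicities $c_v\in\mathbb{Z}_{>0}$ ($v\in V(X)$), total multiplicity $\sum c_v$. Its lift $X'$ is the simple graph on $\bigsqcup_{v}S_v$, $|S_v|=c_v$, each $S_v$ a clique and $u'\in S_u$, $v'\in S_v$ ($u\neq v$) adjacent iff $uv\in E(X)$; $\pi$ maps $S_v$ to $v$; $\overline{X'}$ is the complement of $X'$. $\mathsf{Path}_n$ is the path on $[n]$ with edges $\{i,i+1\}$. $\mathsf{FS}_m(\mathsf{Path}_n,X)$ has vertices the functions $f:[n]\to V(X)$ with $|f^{-1}(v)|=c_v$, with $f,g$ adjacent if $f=g\circ(a\ b)$ for some edge $ab$ of $\mathsf{Path}_n$ with $f(a)f(b)\in E(X)$. For a graph $G$ on $n$ vertices and a bijection $\sigma:[n]\to V(G)$, $\alpha_G(\sigma)$ is the acyclic orientation of $G$ orienting each edge $uv$ as $u\to v$ iff $\sigma^{-1}(u)<\sigma^{-1}(v)$. Let $\mathfrak{S}_X$ be the group of permutations $\rho$ of $V(X')$ with $\rho(S_v)=S_v$ for all $v$. Two acyclic orientations $\alpha,\beta$ of $\overline{X'}$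 are permutation equivalent, $\alpha\equiv\beta$, if some $\rho\in\mathfrak{S}_X$ satisfies: $u\to v$ in $\alpha$ iff $\rho(u)\to\rho(v)$ in $\beta$. *)

(* Defs.v *)
From mathcomp Require Import all_boot perm.

Set Implicit Arguments.
Unset Strict Implicit.
Unset Printing Implicit Defensive.

Record sgraph := SGraph {
  vertex :> finType;
  adj : rel vertex;
  adj_sym : symmetric adj;
  adj_irr : irreflexive adj }.

Arguments adj {s}.

Record mgraph := MGraph {
  mgraph_graph :> sgraph;
  mult : mgraph_graph -> nat;
  mult_gt0 : forall v, 0 < mult v }.

Arguments mult {m}.

Definition total_mult (X : mgraph) : nat := \sum_(v : X) mult v.

Section Complement.
Variable G : sgraph.

Definition compl_adj (u v : G) : bool := (u != v) && ~~ adj u v.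

Lemma compl_adj_sym : symmetric compl_adj.
Proof. by move=> u v; rewrite /compl_adj eq_sym adj_sym. Qed.

Lemma compl_adj_irr : irreflexive compl_adj.
Proof. by move=> u; rewrite /compl_adj eqxx. Qed.

Definition complement : sgraph := SGraph compl_adj_sym compl_adj_irr.
End Complement.

(* The vertex set [n] is represented by 'I_n = {0, ..., n-1}. *)
Section PathGraph.
Variable n : nat.

Definition path_adj (i j : 'I_n) : bool := (i.+1 == j) || (j.+1 == i).

Lemma path_adj_sym : symmetric path_adj.
Proof. by move=> i j; rewrite /path_adj orbC. Qed.

Lemma path_adj_irr : irreflexive path_adj.
Proof. by move=> i; rewrite /path_adj orbb gtn_eqF. Qed.

Definition Path : sgraph := SGraph path_adj_sym path_adj_irr.
End PathGraph.

Section Lift.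
Variable X : mgraph.

Definition lift_vertex : finType := {v : X & 'I_(mult v)}.

Definition lift_proj (x : lift_vertex) : X := tag x.

Definition lift_adj (x y : lift_vertex) : bool :=
  (x != y) && ((lift_proj x == lift_proj y) || adj (lift_proj x) (lift_proj y)).

Lemma lift_adj_sym : symmetric lift_adj.
Proof.
by move=> x y; rewrite /lift_adj eq_sym (eq_sym (lift_proj x)) adj_sym.
Qed.

Lemma lift_adj_irr : irreflexive lift_adj.
Proof. by move=> x; rewrite /lift_adj eqxx. Qed.

Definition lift_graph : sgraph := SGraph lift_adj_sym lift_adj_irr.

Definition fiber (v : X) : {set lift_graph} := [set x | lift_proj x == v].

Lemma card_fiber (v : X) : #|fiber v| = mult v.
Proof.
pose T (i : 'I_(mult v)) : lift_graph := Tagged (fun v : X => 'I_(mult v)) i.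
have T_inj : injective T by move=> i j /eqP; rewrite eq_Tagged => /eqP.
rewrite -[RHS]card_ord -(card_imset _ T_inj); apply: eq_card => x.
rewrite inE; apply/eqP/imsetP => [|[i _ ->]] //.
by case: x => u i /= eq_uv; rewrite /lift_proj /= in eq_uv; subst u; exists i.
Qed.

Definition fiber_perms : {set {perm lift_graph}} :=
  [set rho : {perm lift_graph} | [forall v, rho @: fiber v == fiber v]].
End Lift.

Section FSm.
Variables (Y : sgraph) (X : mgraph).

Definition is_arrangement (f : {ffun Y -> X}) : bool :=
  [forall v, #|[set a | f a == v]| == mult v].

Definition arrangement : finType := {f : {ffun Y -> X} | is_arrangement f}.

Definition FSm_adj (f g : arrangement) : bool :=
  [exists a, exists b, [&& adj a b, adj (val f a) (val f b)
                         & val f == [ffun y => val g (tperm a b y)]]].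

Lemma FSm_adj_sym : symmetric FSm_adj.
Proof.
suff sub f g : FSm_adj f g -> FSm_adj g f by move=> f g; apply/idP/idP; apply: sub.
case/existsP=> a /existsP[b /and3P[ab fab /eqP fE]].
apply/existsP; exists a; apply/existsP; exists b; rewrite ab /=.
move: fab; rewrite fE !ffunE tpermL tpermR adj_sym => -> /=.
by apply/eqP/ffunP => y; rewrite ffunE fE ffunE tpermK.
Qed.

Lemma FSm_adj_irr : irreflexive FSm_adj.
Proof.
move=> f; apply: negbTE; apply/existsP => -[a /existsP[b /and3P[_ fab /eqP /ffunP/(_ a)]]].
by rewrite ffunE tpermL => fE; rewrite fE adj_irr in fab.
Qed.

Definition FSm : sgraph := SGraph FSm_adj_sym FSm_adj_irr.
End FSm.

Definition same_component (G : sgraph) (x y : G) : bool := connect adj x y.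

Record bijection (A B : Type) := Bijection {
  bij_fun :> A -> B;
  bij_inv : B -> A;
  bij_funK : cancel bij_fun bij_inv;
  bij_invK : cancel bij_inv bij_fun }.

Section ProjArrangement.
Variables (Y : sgraph) (X : mgraph) (sigma : bijection Y (lift_graph X)).

Definition proj_fun : {ffun Y -> X} := [ffun a => lift_proj (sigma a)].

Lemma proj_fun_arrangement : is_arrangement proj_fun.
Proof.
apply/forallP => v; apply/eqP; rewrite -card_fiber.
rewrite -(card_imset _ (can_inj (bij_funK sigma))); apply: eq_card => x.
rewrite !inE; apply/imsetP/eqP => [[a]|xv].
  by rewrite inE ffunE => /eqP av ->.
by exists (bij_inv sigma x); rewrite ?inE ?ffunE bij_invK ?xv.
Qed.

Definition proj_arrangement : FSm Y X := Sub proj_fun proj_fun_arrangement.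
End ProjArrangement.

Record acyclic_orientation (G : sgraph) := AcyclicOrientation {
  arc :> rel G;
  arc_adj : forall u v, arc u v -> adj u v;
  arc_orient : forall u v, adj u v -> arc u v = ~~ arc v u;
  arc_acyclic : forall s, cycle arc s -> s = [::] }.

Section Alpha.
Variables (n : nat) (G : sgraph) (sigma : bijection 'I_n G).

Definition alpha_arc (u v : G) : bool :=
  adj u v && (bij_inv sigma u < bij_inv sigma v).

Lemma alpha_arc_adj u v : alpha_arc u v -> adj u v.
Proof. by case/andP. Qed.

Lemma alpha_arc_orient u v : adj u v -> alpha_arc u v = ~~ alpha_arc v u.
Proof.
move=> uv; rewrite /alpha_arc (adj_sym v) uv /=.
case: ltngtP => // /val_inj /(can_inj (bij_invK sigma)) euv.
by rewrite euv adj_irr in uv.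
Qed.

Lemma alpha_arc_acyclic s : cycle alpha_arc s -> s = [::].
Proof.
case: s => // x p /= pth.
pose lt_inv : rel G := relpre (fun u => nat_of_ord (bij_inv sigma u)) ltn.
have lt_tr : transitive lt_inv by move=> b a c; apply: ltn_trans.
have : path lt_inv x (rcons p x) by apply: sub_path pth => u v /andP[].
move/(order_path_min lt_tr)/allP/(_ x); rewrite mem_rcons mem_head /lt_inv /=.
by rewrite ltnn => /(_ isT).
Qed.

Definition alpha : acyclic_orientation G :=
  AcyclicOrientation alpha_arc_adj alpha_arc_orient alpha_arc_acyclic.
End Alpha.

(* The complement of a graph has the same vertex type up to conversion, so a
   bijection onto the lift is also one onto its complement. *)
Definition alpha_compl (n : nat) (X : mgraph)
    (sigma : bijection 'I_n (lift_graph X)) :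
    acyclic_orientation (complement (lift_graph X)) :=
  @alpha n (complement (lift_graph X)) sigma.

Definition perm_equiv (X : mgraph)
    (a b : acyclic_orientation (complement (lift_graph X))) : Prop :=
  exists2 rho : {perm lift_graph X}, rho \in fiber_perms X &
    forall u v : lift_graph X, a u v <-> b (rho u) (rho v).

(* Main.v *)
Require Import Defs.
From mathcomp Require Import all_boot perm.
From mathcomp Require Import zify.

(** Exchanging two consecutive letters of [sigma] that are not adjacent in the
    complement of the lift does not change the induced orientation.  Hence an
    edge of [FS_m] lifts to an exchange preserving the orientation, and two
    bijections with the same projection differ by an element of the fiber
    permutation group.  Conversely, after composing with the witness [rho] we
    may assume that [sigma] and [tau] induce the same orientation; bubble
    sorting the permutation [tau^-1 o sigma] then only exchanges letters that
    [sigma] and [tau] order differently, hence letters that either project to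
    adjacent vertices of [X] (an edge of [FS_m]) or have the same projection
    (nothing changes). *)

Set Implicit Arguments.
Unset Strict Implicit.
Unset Printing Implicit Defensive.

Lemma homo_ltn_ord_ge n (f : 'I_n -> 'I_n) :
  (forall i j : 'I_n, i < j -> f i < f j) -> forall i : 'I_n, i <= f i.
Proof.
move=> f_homo [i]; elim: i => // i IHi lt_i1n /=.
have lt_in := ltnW lt_i1n.
exact: leq_ltn_trans (IHi lt_in) (f_homo (Ordinal lt_in) (Ordinal lt_i1n) _).
Qed.

Lemma homo_ltn_ord_succ n (f : 'I_n -> 'I_n) :
  (forall i j : 'I_n, i.+1 = j -> f i < f j) ->
  forall i j : 'I_n, i < j -> f i < f j.
Proof.
move=> f_succ i [j]; elim: j => // j IHj lt_j1n /=.
have lt_jn := ltnW lt_j1n.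
have lt_fj := f_succ (Ordinal lt_jn) (Ordinal lt_j1n) erefl.
rewrite ltnS leq_eqVlt => /orP[/eqP eq_ij|/(IHj lt_jn) lt_ij].
  by have -> : i = Ordinal lt_jn by apply: val_inj.
exact: ltn_trans lt_fj.
Qed.

(** Without a descent both [p] and its inverse are strictly increasing, hence [i <= p i] and
    [p i <= i] for every [i]. *)
Lemma perm_ord_descent n (p : {perm 'I_n}) :
  p != 1%g -> exists i j : 'I_n, i.+1 = j /\ p j < p i.
Proof.
move=> p_neq1.
have [/existsP[i /existsP[j /andP[/eqP ij ltp]]]|noDescent] :=
  boolP [exists i : 'I_n, exists j : 'I_n, (i.+1 == j) && (p j < p i)].
  by exists i, j.
case/eqP: p_neq1; apply/permP => i; rewrite perm1; apply: val_inj.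
have p_homo (x y : 'I_n) : x < y -> p x < p y.
  move: x y; apply: homo_ltn_ord_succ => {}i j ij.
  rewrite ltn_neqAle leqNgt; apply/andP; split.
    apply/eqP => /val_inj/perm_inj eq_ij; move: ij; rewrite eq_ij; lia.
  apply: contra noDescent => ltp.
  by apply/existsP; exists i; apply/existsP; exists j; rewrite ij eqxx.
have pV_homo (x y : 'I_n) : x < y -> p^-1%g x < p^-1%g y.
  rewrite !ltnNge; apply: contra; rewrite leq_eqVlt.
  case/orP=> [/eqP/val_inj/perm_inj-> //|/p_homo].
  by rewrite !permKV => /ltnW.
apply/eqP; rewrite eqn_leq (homo_ltn_ord_ge p_homo) andbT.
by have := homo_ltn_ord_ge pV_homo (p i); rewrite permK.
Qed.

Section Sorting.
Variable n : nat.
Implicit Type p : {perm 'I_n}.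

(** Termination measure for bubble sort, used in place of the inversion count: undoing a descent at
    [i], [i+1] lowers it by exactly [p i - p (i+1)]. *)
Definition sort_weight p := \sum_(i < n) (n - i) * p i.

Lemma sort_weight_swap p (i j : 'I_n) :
  i.+1 = j -> p j < p i -> sort_weight (tperm i j * p)%g < sort_weight p.
Proof.
move=> ij ltp; have neq_ij : j != i by apply/eqP => eq_ij; move: ij; rewrite eq_ij; lia.
rewrite /sort_weight (bigD1 i) // (bigD1 j) //=.
rewrite [X in _ < X](bigD1 i) // [X in _ < _ + X](bigD1 j) //=.
rewrite !permM tpermL tpermR !addnA.
rewrite (eq_bigr (fun k : 'I_n => (n - k) * p k)); last first.
  by move=> k /andP[ki kj]; rewrite permM tpermD // eq_sym.
by rewrite ltn_add2r; have := ltn_ord j; rewrite -ij; nia.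
Qed.

End Sorting.

Section Bijections.
Variables A B : finType.

Definition bij_perm (s : {perm A}) (f : bijection A B) : bijection A B :=
  @Bijection A B (fun a => f (s a)) (fun b => s^-1%g (bij_inv f b))
    (fun a => etrans (congr1 s^-1%g (bij_funK f (s a))) (permK s a))
    (fun b => etrans (congr1 f (permKV s (bij_inv f b))) (bij_invK f b)).

Definition perm_bij (f : bijection A B) (r : {perm B}) : bijection A B :=
  @Bijection A B (fun a => r (f a)) (fun b => bij_inv f (r^-1%g b))
    (fun a => etrans (congr1 (bij_inv f) (permK r (f a))) (bij_funK f a))
    (fun b => etrans (congr1 r (bij_invK f (r^-1%g b))) (permKV r b)).

Lemma bij_quot_inj (f g : bijection A B) : injective (fun a => bij_inv g (f a)).
Proof. exact: inj_comp (can_inj (bij_invK g)) (can_inj (bij_funK f)). Qed.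

Definition bij_quot (f g : bijection A B) : {perm A} := perm (@bij_quot_inj f g).

Lemma bij_trans_inj (f g : bijection A B) : injective (fun b => g (bij_inv f b)).
Proof. exact: inj_comp (can_inj (bij_funK g)) (can_inj (bij_invK f)). Qed.

Definition bij_trans (f g : bijection A B) : {perm B} := perm (@bij_trans_inj f g).

End Bijections.

(** No position lies strictly between [a] and [b], so the exchange alters the relative order of just
    one pair of letters, and that pair spans no edge of [G]. *)
Lemma alpha_arc_swap n (G : sgraph) (sigma : bijection 'I_n G) (a b : 'I_n) :
    path_adj a b -> ~~ adj (sigma a) (sigma b) ->
  alpha_arc (bij_perm (tperm a b) sigma) =2 alpha_arc sigma.
Proof.
move=> ab nadj u v; rewrite /alpha_arc /= tpermV.
have [uv|] //= := boolP (adj u v).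
rewrite -(bij_invK sigma u) -(bij_invK sigma v) in uv.
move: (bij_inv sigma u) (bij_inv sigma v) uv => x y.
have [->|->|/eqP xa /eqP xb] := tpermP a b x;
  have [->|->|/eqP ya /eqP yb] := tpermP a b y;
  rewrite ?adj_irr ?(negbTE nadj) ?(adj_sym (sigma b)) ?(negbTE nadj) // => _;
  move: ab; rewrite /path_adj;
  repeat match goal with H : is_true (_ != _) |- _ =>
    rewrite -val_eqE /= in H end; lia.
Qed.

Section Components.
Variables (X : mgraph) (n : nat).
Implicit Types sigma tau : bijection 'I_n (lift_graph X).
Local Notation "sigma ^pi" := (@proj_arrangement (Path n) X sigma)
  (at level 2, format "sigma ^pi").
Local Notation arcs sigma := (@alpha_arc n (complement (lift_graph X)) sigma).

(** Fibers are cliques of the lift, so adjacency in the complement depends on projections alone;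
    fiber permutations therefore preserve it. *)
Lemma compl_liftE (u v : lift_graph X) :
  @adj (complement (lift_graph X)) u v =
  (lift_proj u != lift_proj v) && ~~ adj (lift_proj u) (lift_proj v).
Proof.
rewrite /= /compl_adj /= /lift_adj; case: eqVneq => [->|] //=.
  by rewrite eqxx.
by rewrite negb_or.
Qed.

Lemma fiber_permsP (rho : {perm lift_graph X}) :
  reflect (forall u, lift_proj (rho u) = lift_proj u) (rho \in fiber_perms X).
Proof.
rewrite inE; apply: (iffP forallP) => [fix_rho u|fix_rho v].
  have /eqP/setP/(_ (rho u)) := fix_rho (lift_proj u).
  by rewrite imset_f ?inE // => /esym/eqP.
apply/eqP/setP => u; rewrite inE; apply/imsetP/eqP => [[w]|<-].
  by rewrite inE => /eqP <- ->.
exists (rho^-1%g u); rewrite ?permKV // inE.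
by rewrite -[in X in _ == X](permKV rho u) fix_rho.
Qed.

Lemma proj_arrangement_eq sigma tau :
  (forall a, lift_proj (sigma a) = lift_proj (tau a)) -> sigma^pi = tau^pi.
Proof. by move=> eq_pi; apply: val_inj; apply/ffunP => a; rewrite !ffunE. Qed.

Lemma FSm_path_swap sigma (a b : 'I_n) :
    path_adj a b -> adj (lift_proj (sigma a)) (lift_proj (sigma b)) ->
  adj sigma^pi (bij_perm (tperm a b) sigma)^pi.
Proof.
move=> ab adj_ab; apply/existsP; exists a; apply/existsP; exists b.
apply/and3P; split=> //; first by rewrite !ffunE.
by apply/eqP/ffunP => y; rewrite !ffunE /= tpermK.
Qed.

Lemma arcs_fiber_perm sigma rho u v :
  rho \in fiber_perms X ->
  arcs (perm_bij sigma rho) (rho u) (rho v) = arcs sigma u v.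
Proof.
move=> /fiber_permsP fix_rho.
by rewrite /alpha_arc !compl_liftE !fix_rho /= !permK.
Qed.

Lemma same_proj_perm_equiv sigma tau :
  sigma^pi = tau^pi -> perm_equiv (alpha_compl sigma) (alpha_compl tau).
Proof.
move=> /(congr1 val)/ffunP eq_pi.
have rhoP : bij_trans sigma tau \in fiber_perms X.
  apply/fiber_permsP => u; rewrite permE.
  by have := eq_pi (bij_inv sigma u); rewrite !ffunE bij_invK => ->.
exists (bij_trans sigma tau) => // u v; rewrite /= -(arcs_fiber_perm sigma u v rhoP).
(* An orientation sees a bijection only through its inverse, so agreement of the inverses
   suffices. *)
have invE w : bij_inv tau w = bij_inv (perm_bij sigma (bij_trans sigma tau)) w.
  rewrite -[w in LHS](permKV (bij_trans sigma tau)) permE /=.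
  by rewrite bij_funK.
by rewrite /alpha_arc !invE.
Qed.

(** Induction on the walk, with [sigma] general: each edge is lifted to an exchange that keeps the
    orientation, so a fiber permutation is needed only at the end of the walk. *)
Lemma connect_perm_equiv sigma tau :
  connect adj sigma^pi tau^pi ->
  perm_equiv (alpha_compl sigma) (alpha_compl tau).
Proof.
case/connectP=> p; elim: p sigma => [|g p IHp] sigma /=.
  by move=> _ eq_pi; apply: same_proj_perm_equiv.
case/andP=> /existsP[a /existsP[b /and3P[ab adj_ab /eqP fE]]].
rewrite !ffunE in adj_ab.
have -> : g = (bij_perm (tperm a b) sigma)^pi.
  apply: val_inj; apply/ffunP => y; rewrite !ffunE /=.
  have /ffunP/(_ (tperm a b y)) := fE.
  by rewrite !ffunE tpermK => <-.
move=> gp /(IHp _ gp)[rho rhoP eq_arc]; exists rho => // u v.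
rewrite -eq_arc /= alpha_arc_swap // compl_liftE.
by rewrite adj_ab andbF.
Qed.

Lemma eq_arcs_connect sigma tau :
  arcs sigma =2 arcs tau -> connect adj sigma^pi tau^pi.
Proof.
have [m] := ubnP (sort_weight (bij_quot sigma tau)).
elim: m sigma => // m IHm sigma; rewrite ltnS => le_m eq_arc.
have [quot1|/perm_ord_descent[i [j [ij ltq]]]] :=
  eqVneq (bij_quot sigma tau) 1%g.
  rewrite (@proj_arrangement_eq sigma tau) // => a.
  have := permE (@bij_quot_inj _ _ sigma tau) a.
  by rewrite -/(bij_quot sigma tau) quot1 perm1 => {2}->; rewrite bij_invK.
have path_ij : path_adj i j by rewrite /path_adj ij eqxx.
have quot_swap : bij_quot (bij_perm (tperm i j) sigma) tau
               = (tperm i j * bij_quot sigma tau)%g.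
  by apply/permP => x; rewrite permM [LHS]permE [RHS]permE.
(* At a descent [sigma] puts the letter [sigma i] first while [tau] puts [sigma j] first; an edge
   between them would be oriented differently. *)
have nadj : ~~ @adj (complement (lift_graph X)) (sigma i) (sigma j).
  apply/negP => adj_ij; have := eq_arc (sigma i) (sigma j).
  rewrite /alpha_arc adj_ij !bij_funK /= -ij ltnSn.
  by rewrite !permE in ltq; rewrite ltnNge (ltnW ltq).
apply: connect_trans (IHm (bij_perm (tperm i j) sigma) _ _).
- move: nadj; rewrite compl_liftE negb_and !negbK => /orP[/eqP eq_pi|adj_ij].
    rewrite (@proj_arrangement_eq sigma (bij_perm (tperm i j) sigma)) // => a /=.
    by case: tpermP => [->|->|].
  exact/connect1/FSm_path_swap.
- by rewrite quot_swap; apply: leq_trans le_m; apply: sort_weight_swap.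
- by move=> u v; rewrite alpha_arc_swap.
Qed.

Lemma perm_equiv_connect sigma tau :
  perm_equiv (alpha_compl sigma) (alpha_compl tau) ->
  connect adj sigma^pi tau^pi.
Proof.
case=> rho rhoP eq_arc.
(* Relabelling within fibers keeps the arrangement and turns equivalence into equality of
   orientations. *)
rewrite (@proj_arrangement_eq sigma (perm_bij sigma rho)); last first.
  by move=> a /=; rewrite (fiber_permsP _ rhoP).
apply: eq_arcs_connect => u v.
rewrite -(permKV rho u) -(permKV rho v) arcs_fiber_perm //.
by apply/idP/idP => /eq_arc.
Qed.

End Components.

Theorem theorem5p2 (X : mgraph) (n : nat) (hn : total_mult X = n)
    (sigma tau : bijection 'I_n (lift_graph X)) :
  same_component (@proj_arrangement (Path n) X sigma)
                 (@proj_arrangement (Path n) X tau) <->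
  perm_equiv (alpha_compl sigma) (alpha_compl tau).
Proof.
by split; [apply: connect_perm_equiv | apply: perm_equiv_connect].
Qed.
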